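(* Let $S_n=\sum_{k=1}^n X_k$, $S_0=0$, be a biased classical random walk, where $X_1,X_2,\dots$ are independent and identically distributed random variables with $\mathcal P(X_k=1)=p$ and $\mathcal P(X_k=-1)=q$, $p+q=1$, $p\ne q$. Let $A,B\in\mathbb R$, $A,B\ge 0$, and let $\tau=\min\{n\ge0: S_n=A\ \text{or}\ S_n=-B\}$ be the first passage time through $A$ or $-B$. Then $$\mathcal P(S_\tau=A)=\frac{1-\left(\frac qp\right)^{B}}{1-\left(\frac qp\right)^{A+B}},\qquad \mathcal P(S_\tau=-B)=\frac{1-\left(\frac pq\right)^{A}}{1-\left(\frac pq\right)^{A+B}},$$ and $$\mathbb E[\tau]=\frac{B}{q-p}-\frac{A+B}{q-p}\cdot\frac{1-\left(\frac qp\right)^{B}}{1-\left(\frac qp\right)^{A+B}}=\frac{1}{p-q}\left[A\,\frac{1-\left(\frac qp\right)^{B}}{1-\left(\frac qp\right)^{A+B}}-B\,\frac{1-\left(\frac pq\right)^{A}}{1-\left(\frac pq\right)^{A+B}}\right].$$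
   Context: $\mathcal P(S_\tau=A)$ is the probability that the random walk reaches $A$ before $-B$, and similarly $\mathcal P(S_\tau=-B)$ is the probability that it reaches $-B$ before $A$; $\mathbb E[\tau]$ is the expected number of steps needed to reach one of the two barriers.
   Formalization: A and B are taken to be integers, since for e.g. A = B = 1/2 the walk never equals A or −B and the formulas fail; also A + B ≠ 0 (else 0/0) and p, q > 0 (both q/p and p/q occur). *)

(* Defs.v *)
From mathcomp Require Import all_boot all_order all_algebra.
From mathcomp Require Import all_classical all_reals all_analysis.

Set Implicit Arguments.
Unset Strict Implicit.
Unset Printing Implicit Defensive.

Import Order.TTheory GRing.Theory Num.Theory.

Local Open Scope classical_set_scope.
Local Open Scope ring_scope.

Section RandomWalk.
Context {d : measure_display} {T : measurableType d} {R : realType}.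
Variable P : probability T R.

Definition mutually_independent (X : nat -> {RV P >-> R}) : Prop :=
  forall (s : seq nat) (E : nat -> set R), uniq s ->
    (forall k, measurable (E k)) ->
    P (\bigcap_(k in [set` s]) (X k @^-1` E k))
      = (\prod_(k <- s) P (X k @^-1` E k))%E.

Definition identically_distributed (X : nat -> {RV P >-> R}) : Prop :=
  forall (j k : nat) (E : set R), measurable E ->
    P (X j @^-1` E) = P (X k @^-1` E).

Definition iid (X : nat -> {RV P >-> R}) : Prop :=
  mutually_independent X /\ identically_distributed X.

(* The steps X_1, X_2, ... are numbered from 0: [X k] is the (k+1)-st step,
   so that [walk X n] is X_1 + ... + X_n, and [walk X 0] is 0. *)
Definition walk (X : nat -> {RV P >-> R}) (n : nat) (w : T) : R :=
  \sum_(k < n) X k w.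

(* The least n with S_n = A or S_n = -B; it is +oo if there is none. *)
Definition first_passage (S : nat -> T -> R) (A B : R) (w : T) : \bar R :=
  ereal_inf [set (n%:R)%:E | n in [set n : nat | S n w = A \/ S n w = - B]].

(* The event {S_tau = a}; it does not contain outcomes with tau = +oo, where
   S_tau is undefined. *)
Definition stopped_at (S : nat -> T -> R) (tau : T -> \bar R) (a : R) : set T :=
  [set w | exists n : nat, tau w = (n%:R)%:E /\ S n w = a].

End RandomWalk.

(* Main.v *)
(* Shift the walk by B and stop it at 0 and N = A + B. Let v_n(i) be the
   probability of being at i at time n without having visited 0 or N before. If
   p f(j+1) + q f(j-1) = f(j) - c for all 0 < j < N, then summing the one-step
   recursion of v_n over n < m yields
     f(B) = f(0) sum_{n<=m} v_n(0) + f(N) sum_{n<=m} v_n(N)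
            + c sum_{n<m} P(tau > n) + sum_{0<i<N} v_m(i) f(i).
   With f = 1 this bounds the masses by 1; with f(i) = i, where c = q - p <> 0,
   it bounds sum_n P(tau > n), so the last term vanishes in the limit. The
   functions 1, i and (q/p)^i then give three linear equations for
   P(S_tau = -B), P(S_tau = A) and E[tau] = sum_n P(tau > n). *)
Require Import Defs.
From mathcomp Require Import all_boot all_order all_algebra.
From mathcomp Require Import all_classical all_reals all_analysis.
From mathcomp Require Import measurable_realfun ring lra.

Set Implicit Arguments.
Unset Strict Implicit.
Unset Printing Implicit Defensive.

Import Order.TTheory GRing.Theory Num.Theory.
Import numFieldNormedType.Exports.

Local Open Scope classical_set_scope.
Local Open Scope ring_scope.

(** * Finite sums and series with nonnegative terms *)

Lemma sum_endpoints (V : nmodType) (g : nat -> V) (N : nat) : (0 < N)%N ->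
  \sum_(i < N.+1) g i =
  g 0%N + g N + \sum_(i < N.+1) if (0 < i < N)%N then g i else 0.
Proof.
case: N => // N _; rewrite big_ord_recl big_ord_recr /=.
rewrite [in RHS]big_ord_recl [in RHS]big_ord_recr /= ltnn add0r addr0.
rewrite -addrA [g N.+1 + _]addrC; congr (_ + (_ + _)).
by apply: eq_bigr => i _; rewrite /bump leq0n add1n ltnS ltn_ord.
Qed.

Lemma series_ge0 (R : realType) (u : nat -> R) n :
  (forall j, 0 <= u j) -> 0 <= series u n.
Proof. by move=> u0; apply: sumr_ge0. Qed.

(** The bound is asked at [n.+1] because mass conservation controls the partial sums in that
    form. *)
Lemma cvg_series_bounded (R : realType) (u : nat -> R) (M : R) :
  (forall j, 0 <= u j) -> (forall n, series u n.+1 <= M) -> cvgn (series u).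
Proof.
move=> u0 uM; apply: nondecreasing_is_cvgn.
  by apply: nondecreasing_series.
exists M => _ [n _ <-]; apply: le_trans (uM n).
by rewrite seriesSr lerDl.
Qed.

Lemma nneseries_EFin (R : realType) (u : R^nat) : cvgn (series u) ->
  (\sum_(0 <= n <oo) (u n)%:E)%E = (limn (series u))%:E.
Proof.
move=> cu; rewrite -EFin_lim //; congr (limn _); apply/funext => n.
by rewrite /= sumEFin.
Qed.

Lemma set_cons_setU (x : nat) (s : seq nat) : [set` x :: s] = x |` [set` s].
Proof.
apply/seteqP; split=> y /=; rewrite inE.
  by case/orP=> [/eqP|]; [left|right].
by case=> [->|->]; rewrite ?eqxx ?orbT.
Qed.

(** * The absorbed walk as a deterministic recursion on [0..N] *)

Section ExitLaw.
Context {R : realType}.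
Variables (p q : R) (N b : nat).

Definition inner (u : nat -> R) (i : nat) : R :=
  if (0 < i < N)%N then u i else 0.

(** This is v_n(i). Only [inner] mass moves on, so mass arriving at a barrier is counted once and
    then dropped. The truncation [0.-1 = 0] is harmless, since [inner] vanishes at [0]. *)
Fixpoint exit_law (n : nat) : nat -> R :=
  if n is m.+1
  then fun i => p * inner (exit_law m) i.-1 + q * inner (exit_law m) i.+1
  else fun i => (i == b)%:R.

Definition survival (n : nat) : R := \sum_(i < N.+1) inner (exit_law n) i.

Lemma inner0 u : inner u 0 = 0. Proof. by []. Qed.

Lemma innerN u : inner u N = 0.
Proof. by rewrite /inner ltnn andbF. Qed.

Lemma innerSN u : inner u N.+1 = 0.
Proof. by rewrite /inner [(N.+1 < N)%N]ltnNge leqnSn. Qed.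

(** Passing to the adjoint: index shifts move the transition step from the mass to the test
    function, and the leftover terms sit at [0], [N] and [N.+1], where [inner] vanishes. *)
Lemma inner_step_sum (u f : nat -> R) :
  \sum_(i < N.+1) (p * inner u i.-1 + q * inner u i.+1) * f i =
  \sum_(i < N.+1) inner u i * (p * f i.+1 + q * f i.-1).
Proof.
under eq_bigr do rewrite mulrDl.
under [RHS]eq_bigr do rewrite mulrDr.
rewrite !big_split /=; congr (_ + _).
  rewrite big_ord_recl inner0 mulr0 mul0r add0r big_ord_recr /= innerN mul0r.
  rewrite addr0; apply: eq_bigr => i _ /=.
  by rewrite /bump leq0n add1n /=; ring.
rewrite big_ord_recr /= innerSN mulr0 mul0r addr0 big_ord_recl /= inner0 mul0r.
by rewrite add0r; apply: eq_bigr => i _ /=; rewrite /bump leq0n add1n /=; ring.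
Qed.

Hypothesis N_gt0 : (0 < N)%N.
Hypothesis b_leN : (b <= N)%N.

Lemma sum_inner (u f : nat -> R) : \sum_(i < N.+1) u i * f i =
  u 0%N * f 0%N + u N * f N + \sum_(i < N.+1) inner u i * f i.
Proof.
rewrite (@sum_endpoints _ (fun i => u i * f i) _ N_gt0); congr (_ + _).
by apply: eq_bigr => i _; rewrite /inner; case: ifP => _; rewrite ?mul0r.
Qed.

(** Induction on [n]: the adjoint step turns the interior sum into [c * survival n] plus the full
    sum at time [n.+1], whose two endpoint terms extend the barrier series. Hence the barrier series
    include time [n], while the survival series stops just before it. *)
Lemma exit_law_balance (f : nat -> R) (c : R) (n : nat) :
  (forall j, (0 < j < N)%N -> p * f j.+1 + q * f j.-1 = f j - c) ->
  f b = series (exit_law^~ 0%N) n.+1 * f 0%N + series (exit_law^~ N) n.+1 * f N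
        + c * series survival n + \sum_(i < N.+1) inner (exit_law n) i * f i.
Proof.
move=> fc; elim: n => [|n IHn].
  have s0 (u : R^nat) : series u 0%N = 0 by rewrite /series /= big_geq.
  rewrite !seriesSr !s0 mulr0 !add0r addr0 -sum_inner /=.
  rewrite (bigD1 (inord b)) //= inordK ?ltnS // eqxx mul1r big1 ?addr0 //.
  move=> i ib; case: eqP => [ibE|]; rewrite ?mul0r //; case/eqP: ib.
  by apply: val_inj; rewrite /= inordK ?ltnS.
rewrite IHn (seriesSr (exit_law^~ 0%N) n.+1) (seriesSr (exit_law^~ N) n.+1)
  (seriesSr survival n).
have -> : \sum_(i < N.+1) inner (exit_law n) i * f i =
    c * survival n + \sum_(i < N.+1) exit_law n.+1 i * f i.
  rewrite inner_step_sum /survival mulr_sumr -big_split /=.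
  apply: eq_bigr => i _; rewrite /inner; case: ifP => [/fc ->|_]; ring.
by rewrite (sum_inner (exit_law n.+1)); ring.
Qed.

Hypotheses (p_ge0 : 0 <= p) (q_ge0 : 0 <= q) (pq1 : p + q = 1).

Lemma inner_ge0 u i : (forall j, 0 <= u j) -> 0 <= inner u i.
Proof. by move=> u0; rewrite /inner; case: ifP. Qed.

Lemma exit_law_ge0 n i : 0 <= exit_law n i.
Proof.
elim: n i => [|n IHn] i /=; first exact: ler0n.
by rewrite addr_ge0 // mulr_ge0 // inner_ge0.
Qed.

Lemma survival_ge0 n : 0 <= survival n.
Proof. by apply: sumr_ge0 => i _; apply: inner_ge0; exact: exit_law_ge0. Qed.

(** Conservation of mass: the balance for the constant function 1, with [c = 0]. *)
Lemma exit_law_mass n :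
  series (exit_law^~ 0%N) n.+1 + series (exit_law^~ N) n.+1 + survival n = 1.
Proof.
rewrite [RHS](@exit_law_balance (fun=> 1) 0 n); last first.
  by move=> j _; rewrite !mulr1 subr0.
rewrite mul0r !mulr1 addr0; congr (_ + _).
by apply: eq_bigr => i _; rewrite mulr1.
Qed.

Lemma series_exit_law_ge0 i n : 0 <= series (exit_law^~ i) n.
Proof. by apply: series_ge0 => j; exact: exit_law_ge0. Qed.

Lemma cvg_exit_law0 : cvgn (series (exit_law^~ 0%N)).
Proof.
apply: (@cvg_series_bounded _ _ 1) => [j|n]; first exact: exit_law_ge0.
by rewrite -(exit_law_mass n) -addrA lerDl addr_ge0 ?survival_ge0
  ?series_exit_law_ge0.
Qed.

Lemma cvg_exit_lawN : cvgn (series (exit_law^~ N)).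
Proof.
apply: (@cvg_series_bounded _ _ 1) => [j|n]; first exact: exit_law_ge0.
by rewrite -(exit_law_mass n) -addrA addrCA lerDl addr_ge0 ?survival_ge0
  ?series_exit_law_ge0.
Qed.

(** Controls the remainder of the balance, which thus vanishes in the limit as soon as [survival]
    does. *)
Lemma survival_weighted_bound (f : nat -> R) n :
  `|\sum_(i < N.+1) inner (exit_law n) i * f i| <=
  (\sum_(i < N.+1) `|f i|) * survival n.
Proof.
rewrite mulr_sumr (le_trans (ler_norm_sum _ _ _)) // ler_sum // => i _.
have i0 : 0 <= inner (exit_law n) i by apply: inner_ge0; exact: exit_law_ge0.
rewrite normrM (ger0_norm i0) mulrC ler_wpM2r //.
by rewrite (bigD1 i) //= lerDl sumr_ge0.
Qed.

Hypothesis pq_neq : p != q.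

Lemma cvg_survival : cvgn (series survival).
Proof.
pose f (i : nat) : R := i%:R; pose C := \sum_(i < N.+1) `|f i|.
have C0 : 0 <= C by exact: sumr_ge0.
(* The numerator bounds [f b], the term at [N] (the factor 2 is slack) and the remainder, after
   solving the balance for [(q - p) * series survival n]. The final 1 pays for the last term of
   [series survival n.+1]. *)
apply: (@cvg_series_bounded _ _ ((b%:R + 2 * N%:R + C) / `|q - p| + 1)) => [j|n].
  exact: survival_ge0.
have survle1 m : survival m <= 1.
  by rewrite -(exit_law_mass m) lerDr addr_ge0 ?series_exit_law_ge0.
rewrite seriesSr lerD //.
have qp : 0 < `|q - p| by rewrite normr_gt0 subr_eq0 eq_sym.
rewrite ler_pdivlMr // -[series _ _]ger0_norm; last first.
  by apply: series_ge0 => j; exact: survival_ge0.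
rewrite -normrM mulrC.
have -> : (q - p) * series survival n = f b
  - series (exit_law^~ N) n.+1 * f N
  - \sum_(i < N.+1) inner (exit_law n) i * f i.
  rewrite (@exit_law_balance f (q - p) n); first by rewrite [f 0%N]/f; ring.
  move=> [//|j] _; rewrite /f /= -!natr1.
  have -> : q = 1 - p by move: pq1; lra.
  by ring.
have wC := survival_weighted_bound f n.
have w1 : C * survival n <= C by rewrite ler_piMr.
apply: le_trans (ler_normB _ _) _; apply: lerD; last exact: le_trans wC w1.
apply: le_trans (ler_normB _ _) _.
have l1 : series (exit_law^~ N) n.+1 <= 1.
  by rewrite -(exit_law_mass n) -addrA addrCA lerDl addr_ge0 ?survival_ge0
    ?series_exit_law_ge0.
have l0 : 0 <= series (exit_law^~ N) n.+1.
  exact: series_exit_law_ge0.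
rewrite /f ger0_norm // normrM !ger0_norm // lerD2l.
have N0 : 0 <= N%:R :> R by [].
nra.
Qed.

Lemma exit_law_limit (f : nat -> R) (c : R) :
  (forall j, (0 < j < N)%N -> p * f j.+1 + q * f j.-1 = f j - c) ->
  f b = limn (series (exit_law^~ 0%N)) * f 0%N
        + limn (series (exit_law^~ N)) * f N + c * limn (series survival).
Proof.
move=> fc; pose rest n := \sum_(i < N.+1) inner (exit_law n) i * f i.
(* A convergent series has terms tending to 0, so [survival] squeezes the remainder to 0. *)
have rest0 : rest @ \oo --> (0 : R).
  apply: norm_cvg0.
  apply: (@squeeze_cvgr _ _ _ _ (fun=> 0)
    (fun n => (\sum_(i < N.+1) `|f i|) * survival n)).
  - by apply: nearW => n; rewrite normr_ge0 /=; exact: survival_weighted_bound.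
  - exact: cvg_cst.
  - rewrite -[X in _ --> X](mulr0 (\sum_(i < N.+1) `|f i|)); apply: cvgMr.
    exact: cvg_series_cvg_0 cvg_survival.
have cvgS (u : R^nat) : cvgn (series u) ->
    (fun n => series u n.+1) @ \oo --> limn (series u).
  by move=> cu; rewrite (@cvg_shiftS R).
(* The balance writes the constant [f b] as a sequence in [n]; uniqueness of limits then gives the
   identity. *)
set L := RHS; suff : (fun=> f b : R) @ \oo --> L + 0.
  by rewrite addr0 => /(cvg_lim (@Rhausdorff R)) <-; rewrite lim_cst.
have -> : (fun=> f b) = (fun n => series (exit_law^~ 0%N) n.+1 * f 0%N
    + series (exit_law^~ N) n.+1 * f N + c * series survival n + rest n).
  by apply/funext => n; exact: exit_law_balance.
apply: cvgD rest0; apply: cvgD; last first.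
  by apply: cvgMr; exact: cvg_survival.
apply: cvgD; apply: cvgMl; apply: cvgS.
  exact: cvg_exit_law0.
exact: cvg_exit_lawN.
Qed.

End ExitLaw.

(** * Independence of past events from later steps *)

Section IndependentSteps.
Context {d : measure_display} {T : measurableType d} {R : realType}.
Variables (P : probability T R) (X : nat -> {RV P >-> R}).

(* Quantifying over all finite families of later steps, and not only over the
   next one, is what makes this property propagate by induction on [n]. *)
Definition independent_from (n : nat) (E : set T) : Prop :=
  measurable E /\ forall (s : seq nat) (F : nat -> set R),
    uniq s -> all (leq n) s -> (forall k, measurable (F k)) ->
    P (E `&` \bigcap_(k in [set` s]) (X k @^-1` F k))
      = (P E * \prod_(k <- s) P (X k @^-1` F k))%E.

Lemma measurable_bigcap_steps (s : seq nat) (F : nat -> set R) :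
  (forall k, measurable (F k)) ->
  measurable (\bigcap_(k in [set` s]) (X k @^-1` F k)).
Proof.
by move=> mF; apply: bigcap_measurableType => k _; exact: measurable_funPTI.
Qed.

Lemma independent_from_setT : mutually_independent X -> independent_from 0 setT.
Proof.
move=> Xind; split=> // s F us _ mF.
by rewrite setTI probability_setT mul1e Xind.
Qed.

Lemma independent_from_set0 n : independent_from n set0.
Proof. by split=> // s F us _ mF; rewrite set0I measure0 mul0e. Qed.

Lemma independent_fromU n E1 E2 : independent_from n E1 ->
  independent_from n E2 -> E1 `&` E2 = set0 -> independent_from n (E1 `|` E2).
Proof.
move=> [mE1 iE1] [mE2 iE2] E120; split=> [|s F us ns mF].
  exact: measurableU.
have mG := @measurable_bigcap_steps s F mF.
set G := \bigcap_(k in _) _ in mG *.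
have PU (C D : set T) : measurable C -> measurable D -> C `&` D = set0 ->
    P (C `|` D) = (P C + P D)%E by move=> mC mD; exact: measureU.
rewrite setIUl PU; last by rewrite setIACA E120 set0I.
- by rewrite PU // ge0_muleDl // (iE1 s F) // (iE2 s F).
- exact: measurableI.
- exact: measurableI.
Qed.

(** Independence of [E] is applied to the enlarged family [n :: s], so that step [n] can be absorbed
    into the event. *)
Lemma independent_from_step n E B : independent_from n E -> measurable B ->
  independent_from n.+1 (E `&` X n @^-1` B)
  /\ P (E `&` X n @^-1` B) = (P E * P (X n @^-1` B))%E.
Proof.
move=> [mE iE] mB.
have PEB : P (E `&` X n @^-1` B) = (P E * P (X n @^-1` B))%E.
  have := iE [:: n] (fun=> B) isT.
  by rewrite /= leqnn set_cons1 bigcap_set1 big_seq1 => ->.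
split=> //; split=> [|s F us ns mF].
  by apply: measurableI => //; exact: measurable_funPTI.
(* One family carrying [B] at [n] and [F] elsewhere; it agrees with [F] on [s], whose indices all
   exceed [n]. *)
pose F' k := if k == n then B else F k.
have nNs k : k \in s -> (k == n) = false.
  move=> ks; apply/negbTE; move/allP: ns => /(_ _ ks).
  by rewrite neq_ltn orbC => ->.
have cap : \bigcap_(k in [set` s]) (X k @^-1` F' k) =
           \bigcap_(k in [set` s]) (X k @^-1` F k).
  by apply: eq_bigcapr => k /= ks; rewrite /F' nNs.
have prod : (\prod_(k <- s) P (X k @^-1` F' k) =
             \prod_(k <- s) P (X k @^-1` F k))%E.
  by apply: eq_big_seq => k ks; rewrite /F' nNs.
have uns : uniq (n :: s).
  by rewrite /= us andbT; apply/negP => /nNs; rewrite eqxx.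
have lns : all (leq n) (n :: s).
  by rewrite /= leqnn; apply/allP => k /(allP ns) /ltnW.
have mF' k : measurable (F' k) by rewrite /F'; case: ifP.
have := iE _ _ uns lns mF'.
rewrite set_cons_setU bigcap_setU1 big_cons cap prod {1 2}/F' eqxx.
by rewrite setIA PEB muleA.
Qed.

End IndependentSteps.

(** * Paths of the walk before absorption *)

Section Passage.
Context {d : measure_display} {T : measurableType d} {R : realType}.
Variables (P : probability T R) (X : nat -> {RV P >-> R}).
Variables (p q : R) (a b : nat).

Local Notation S := (walk X).
Local Notation N := (a + b)%N.
Local Notation A := (a%:R : R).
Local Notation B := (b%:R : R).

(* Positions are shifted by [B]: [reach n i] is the event that the walk moves by
   +1 or -1 steps to [i - B] at time [n], avoiding both barriers before. *)
Fixpoint reach (n : nat) (i : nat) : set T :=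
  if n is m.+1 then
    ((if (0 < i.-1 < N)%N then reach m i.-1 else set0) `&` X m @^-1` [set 1])
    `|` ((if (0 < i.+1 < N)%N then reach m i.+1 else set0)
         `&` X m @^-1` [set -1])
  else if i == b then setT else set0.

(** The inequality is strict: a barrier may be hit at time [n] itself, so {tau > n} is
    [unabsorbed n.+1]. *)
Definition unabsorbed (n : nat) : set T :=
  [set w | forall m, (m < n)%N -> S m w <> A /\ S m w <> - B].

(** The steps are real-valued and equal 1 or -1 only almost surely, so pathwise arguments are
    confined to this event. *)
Definition unit_steps : set T := [set w | forall k, X k w = 1 \/ X k w = -1].

Lemma walkS n w : S n.+1 w = S n w + X n w.
Proof. by rewrite /walk big_ord_recr. Qed.

Lemma unabsorbedS n w :
  unabsorbed n.+1 w <-> unabsorbed n w /\ (S n w <> A /\ S n w <> - B).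
Proof.
split=> [H|[H Hn] m].
  by split; [move=> m mn; apply: H; exact: ltnW | exact: H].
by rewrite ltnS leq_eqVlt => /orP[/eqP->//|]; exact: H.
Qed.

Lemma interior_position (i : nat) : (0 < i < N)%N ->
  i%:R - B <> A /\ i%:R - B <> - B.
Proof.
move=> /andP[i0 iN]; split=> /eqP.
  by rewrite subr_eq -natrD eqr_nat (ltn_eqF iN).
by rewrite subr_eq addNr (eqr_nat R i 0) gtn_eqF.
Qed.

Lemma reach_walk n i w : reach n i w -> S n w = i%:R - B /\ unabsorbed n w.
Proof.
elim: n i => [|n IHn] i /=.
  case: eqP => // -> _; split; last by move=> m.
  by rewrite /walk big_ord0 subrr.
case=> -[+ Xn]; case: ifP => // iN /IHn[Sn un].
  split; last by apply/unabsorbedS; rewrite Sn; split=> //;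
    exact: interior_position.
  case: i iN Sn => [//|i] iN Sn.
  by rewrite walkS Sn Xn /= -natr1; ring.
split; last by apply/unabsorbedS; rewrite Sn; split=> //;
    exact: interior_position.
by rewrite walkS Sn Xn -natr1; ring.
Qed.

(** A path with unit steps cannot jump over a barrier: an unabsorbed position at time [n] is
    strictly between [0] and [N], so its neighbours remain in [0..N]. *)
Lemma reach_exists n w : unit_steps w -> unabsorbed n w ->
  exists2 i, (i <= N)%N & reach n i w.
Proof.
move=> uw; elim: n => [_|n IHn].
  by exists b; [exact: leq_addl | rewrite /= eqxx].
move=> /unabsorbedS[/IHn[i iN rni] [SA SB]].
have [Sn _] := reach_walk rni; rewrite Sn in SA SB.
have i0 : (0 < i)%N.
  by rewrite lt0n; apply/eqP => i0; apply: SB; rewrite i0 sub0r.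
have {}iN : (i < N)%N.
  rewrite ltn_neqAle iN andbT; apply/eqP => iN'; apply: SA.
  by rewrite iN' natrD addrK.
case: (uw n) => Xn.
  by exists i.+1 => //=; left; split=> //; rewrite i0 iN.
exists i.-1; first by rewrite (leq_trans (leq_pred _)) // ltnW.
by right; split=> //; rewrite prednK // i0 iN.
Qed.

Lemma reach_inj n i j w : reach n i w -> reach n j w -> i = j.
Proof.
move=> /reach_walk[Sn _] /reach_walk[]; rewrite Sn.
by move=> /addIr/eqP; rewrite eqr_nat => /eqP.
Qed.

Lemma reachE n i w : unit_steps w ->
  reach n i w <-> [/\ (i <= N)%N, S n w = i%:R - B & unabsorbed n w].
Proof.
move=> uw; split=> [rni|[iN Sn un]].
  have [Sn un] := reach_walk rni; have [j jN rnj] := reach_exists uw un.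
  by rewrite (reach_inj rni rnj); split=> //; case: (reach_walk rnj).
have [j jN rnj] := reach_exists uw un; have [+ _] := reach_walk rnj.
by rewrite Sn => /addIr/eqP; rewrite eqr_nat => /eqP ->.
Qed.

(** * Probabilities of the [reach] events *)

Hypothesis Xind : mutually_independent X.
Hypothesis XP : forall k : nat, P [set w | X k w = 1] = p%:E.
Hypothesis XN : forall k : nat, P [set w | X k w = -1] = q%:E.

(** Both claims go through one induction: the factors [p] and [q] come from independence of step
    [n], and the new event must again be independent of what follows. The two ways of arriving are
    disjoint, as the last step differs. *)
Lemma reach_law n i :
  independent_from X n (reach n i) /\ P (reach n i) = (exit_law p q N b n i)%:E.
Proof.
elim: n i => [|n IHn] i /=.
  case: eqP => _; rewrite ?probability_setT ?measure0; split=> //.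
    exact: independent_from_setT.
  exact: independent_from_set0.
have IHin j : independent_from X n (if (0 < j < N)%N then reach n j else set0)
    /\ P (if (0 < j < N)%N then reach n j else set0)
       = (inner N (exit_law p q N b n) j)%:E.
  rewrite /inner; case: ifP => // _.
  by split; [exact: independent_from_set0 | rewrite measure0].
have [iu Pu] := IHin i.-1; have [il Pl] := IHin i.+1.
have XPE : P (X n @^-1` [set 1]) = p%:E := XP n.
have XNE : P (X n @^-1` [set -1]) = q%:E := XN n.
have [iu1 Pu1] := independent_from_step iu (measurable_set1 (1 : R)).
have [il1 Pl1] := independent_from_step il (measurable_set1 (-1 : R)).
rewrite XPE Pu in Pu1; rewrite XNE Pl in Pl1.
set U := _ `&` X n @^-1` [set 1] in iu1 Pu1 *.
set L := _ `&` X n @^-1` [set -1] in il1 Pl1 *.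
have UL0 : U `&` L = set0.
  apply/seteqP; split=> // w [[_ /= X1] [_ /= XN1]].
  by move/eqP: X1; rewrite XN1 -subr_eq0 -opprD oppr_eq0 (eqr_nat R 2 0).
split; first exact: independent_fromU.
have -> : P (U `|` L) = (P U + P L)%E.
  by apply: measureU => //; [exact: iu1.1 | exact: il1.1].
by rewrite Pu1 Pl1 -!EFinM -EFinD mulrC [_ * q]mulrC.
Qed.

Lemma measurable_reach n i : measurable (reach n i).
Proof. by have [[]] := reach_law n i. Qed.

Lemma P_reach n i : P (reach n i) = (exit_law p q N b n i)%:E.
Proof. by have [] := reach_law n i. Qed.

Lemma measurable_walk n : measurable_fun setT (S n).
Proof.
rewrite [S n](_ : _ = fun w => \sum_(k < n) X k w) //.
by apply: measurable_sum => k; exact: measurable_funPT.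
Qed.

Lemma measurable_walk_eq n (x : R) : measurable [set w | S n w = x].
Proof.
rewrite -[X in measurable X]setTI.
exact: (measurable_walk n measurableT (measurable_set1 x)).
Qed.

Lemma measurable_unabsorbed n : measurable (unabsorbed n).
Proof.
have -> : unabsorbed n = \bigcap_(m in `I_n)
    (~` [set w | S m w = A] `&` ~` [set w | S m w = - B]).
  by apply/seteqP; split=> w H m; exact: H.
apply: bigcap_measurableType => m _.
by apply: measurableI; apply: measurableC; exact: measurable_walk_eq.
Qed.

(** * Almost sure unit steps *)

Hypothesis pq1 : p + q = 1.

Lemma unit_stepsE : ~` unit_steps =
  \bigcup_k ~` (X k @^-1` [set 1] `|` X k @^-1` [set -1]).
Proof.
rewrite -setC_bigcap; congr (~` _).
by apply/seteqP; split=> w H k; [move=> _ | ]; exact: H.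
Qed.

Lemma measurable_unit_step k :
  measurable (X k @^-1` [set 1] `|` X k @^-1` [set -1]).
Proof. by apply: measurableU; exact: measurable_funPTI. Qed.

Lemma measurable_not_unit_steps : measurable (~` unit_steps).
Proof.
rewrite unit_stepsE; apply: bigcupT_measurable => k; apply: measurableC.
exact: measurable_unit_step.
Qed.

Lemma P_not_unit_steps : P (~` unit_steps) = 0%E.
Proof.
have P0 k : P (~` (X k @^-1` [set 1] `|` X k @^-1` [set -1])) = 0%E.
  rewrite probability_setC; last exact: measurable_unit_step.
  have -> : P (X k @^-1` [set 1] `|` X k @^-1` [set -1]) = (p%:E + q%:E)%E.
    rewrite -(XP k) -(XN k); apply: measureU; try exact: measurable_funPTI.
    apply/seteqP; split=> // w [/= X1 XN1].
    by move/eqP: X1; rewrite XN1 -subr_eq0 -opprD oppr_eq0 (eqr_nat R 2 0).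
  by rewrite -EFinD pq1 subrr.
apply/(negligibleP P measurable_not_unit_steps).
rewrite unit_stepsE; apply: negligible_bigcup => k.
apply/(negligibleP P); last exact: P0.
by apply: measurableC; exact: measurable_unit_step.
Qed.

Lemma P_eq_unit_steps (E F : set T) : measurable E -> measurable F ->
  (forall w, unit_steps w -> E w <-> F w) -> P E = P F.
Proof.
move=> mE mF EF.
have mZ := measurable_not_unit_steps; have Z0 := P_not_unit_steps.
rewrite -(measureU0 mE mZ Z0) -(measureU0 mF mZ Z0); congr (P _).
apply/seteqP; split=> w; have [uw|nuw] := pselect (unit_steps w);
  by [case=> // /EF; left; auto | right].
Qed.

(** * Law and mean of the first passage time *)

Let tau := first_passage S A B.

Lemma first_passage_fin n w : unabsorbed n w -> S n w = A \/ S n w = - B ->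
  tau w = n%:R%:E.
Proof.
move=> un Sn; apply/eqP; rewrite eq_le; apply/andP; split.
  by apply: ereal_inf_lbound; exists n.
apply: le_ereal_inf_tmp => _ [m Sm <-]; rewrite lee_fin ler_nat leqNgt.
by apply/negP => /un[]; case: Sm.
Qed.

Lemma first_passage_pinfty w : (forall n, unabsorbed n w) -> tau w = +oo%E.
Proof.
move=> un; rewrite /tau /first_passage [X in ereal_inf X](_ : _ = set0).
  exact: ereal_inf0.
apply/seteqP; split=> // _ [n /= Sn _].
by have [] := un n.+1 n (ltnSn n); case: Sn.
Qed.

Lemma first_passage_dichotomy w : (forall n, unabsorbed n w) \/
  exists n, unabsorbed n w /\ (S n w = A \/ S n w = - B).
Proof.
have [[n Sn]|noS] := pselect (exists n, S n w = A \/ S n w = - B); last first.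
  by left=> n m _; split=> Sm; apply: noS; exists m; [left|right].
right; have exS : exists n, `[< S n w = A \/ S n w = - B >].
  by exists n; exact/asboolP.
exists (ex_minn exS); case: ex_minnP => m /asboolP Sm mmin; split=> // k km.
have nSk : ~ (S k w = A \/ S k w = - B).
  by move=> /asboolP/mmin; rewrite leqNgt km.
by split=> Sk; apply: nSk; auto.
Qed.

(** Splits by the hitting time, to prepare for countable additivity; as [x] is a barrier, an
    unabsorbed visit to it at time [n] forces [tau = n]. *)
Lemma stopped_atE (x : R) : x = A \/ x = - B ->
  stopped_at S tau x = \bigcup_n (unabsorbed n `&` [set w | S n w = x]).
Proof.
move=> xAB; apply/seteqP; split=> w.
  move=> [n [tn Sn]]; exists n => //; split=> //.
  have [un|[m [um Sm]]] := first_passage_dichotomy w; first exact: un.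
  move: tn; rewrite (first_passage_fin um Sm) => -[] /eqP.
  by rewrite eqr_nat => /eqP <-.
move=> [n _ [un Sn]]; exists n; split=> //; apply: first_passage_fin => //.
by rewrite Sn.
Qed.

(** The tail formula, tau as the sum of the indicators of {tau > n}, holds pointwise, also where
    [tau] is infinite. *)
Lemma first_passage_tail_sum w :
  tau w = (\sum_(0 <= n <oo) (\1_(unabsorbed n.+1) w)%:E)%E.
Proof.
have [un|[n [un Sn]]] := first_passage_dichotomy w.
  rewrite first_passage_pinfty //; apply/esym/eq_infty => r.
  (* When no barrier is ever hit all indicators are 1, so [k] terms suffice to exceed [r]. *)
  pose k := (Num.truncn `|r|).+1.
  have rk : r <= k%:R.
    by rewrite (le_trans (ler_norm r)) // ltW // truncnS_gt.
  apply: (@le_trans _ _ (\sum_(0 <= n < k) (\1_(unabsorbed n.+1) w)%:E)%E).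
    rewrite (eq_bigr (fun=> 1%:E)); last by move=> i _; rewrite indicE mem_set.
    by rewrite sumEFin sumr_const_nat subn0 lee_fin.
  by apply: nneseries_lim_ge => n _ _; rewrite lee_fin.
rewrite (first_passage_fin un Sn) (nneseries_split 0 n); last first.
  by move=> k _; rewrite lee_fin.
rewrite add0n eseries0 ?adde0; last first.
  move=> i ni _; rewrite indicE memNset // => /(_ n ni)[].
  by case: Sn.
rewrite (eq_big_nat _ _ (F2 := fun=> 1%:E)); last first.
  move=> i /andP[_ ni]; rewrite indicE mem_set // => m mi.
  by apply: un; exact: leq_trans mi ni.
by rewrite sumEFin sumr_const_nat subn0.
Qed.

(** Countable additivity over the hitting time; on unit steps the piece at time [n] is
    [reach n i]. *)
Lemma P_stopped_at i : i = 0%N \/ i = N ->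
  cvgn (series (exit_law p q N b ^~ i)) ->
  P (stopped_at S tau (i%:R - B)) = (limn (series (exit_law p q N b ^~ i)))%:E.
Proof.
move=> i0N ci.
have xAB : i%:R - B = A \/ i%:R - B = - B.
  by case: i0N => ->; [right; rewrite sub0r | left; rewrite natrD addrK].
have iN : (i <= N)%N by case: i0N => ->.
rewrite stopped_atE // measure_semi_bigcup.
- rewrite -nneseries_EFin //; apply: eq_eseriesr => n _; rewrite -P_reach.
  apply: P_eq_unit_steps.
  + apply: measurableI; first exact: measurable_unabsorbed.
    exact: measurable_walk_eq.
  + exact: measurable_reach.
  + by move=> w uw; rewrite reachE //; split=> [[]|[]].
- move=> n; apply: measurableI; first exact: measurable_unabsorbed.
  exact: measurable_walk_eq.
- apply: ltn_trivIset => n m nm; apply/seteqP; split=> // w [[_ /= Sm] [un _]].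
  by have [] := un m nm; rewrite Sm; case: xAB.
- apply: bigcupT_measurable => n; apply: measurableI.
    exact: measurable_unabsorbed.
  exact: measurable_walk_eq.
Qed.

(** Splits by the current position, which is interior and, by [reach_inj], unique. *)
Lemma P_unabsorbed n : P (unabsorbed n.+1) = (survival p q N b n)%:E.
Proof.
pose F i := if (0 < i < N)%N then reach n i else set0.
have mF i : measurable (F i).
  by rewrite /F; case: ifP => // _; exact: measurable_reach.
have tF : trivIset setT F.
  apply/trivIsetP => i j _ _ ij; apply/seteqP; split=> // w [].
  rewrite /F; case: ifP => // _ ri; case: ifP => // _ /(reach_inj ri) ijE.
  by rewrite ijE eqxx in ij.
have PF i : P (F i) = (inner N (exit_law p q N b n) i)%:E.
  by rewrite /F /inner; case: ifP; rewrite ?measure0 // P_reach.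
rewrite (@P_eq_unit_steps _ (\big[setU/set0]_(i < N.+1) F i)).
- rewrite measure_bigsetU // /survival -sumEFin; apply: eq_bigr => i _.
  exact: PF.
- exact: measurable_unabsorbed.
- exact: bigsetU_measurable.
move=> w uw; rewrite unabsorbedS -bigcup_mkord; split.
  move=> [un [SA SB]]; have [i iN ri] := reach_exists uw un.
  exists i => //; rewrite /F ifT //; have [Sn _] := reach_walk ri.
  rewrite Sn in SA SB; rewrite lt0n ltn_neqAle iN andbT.
  apply/andP; split; apply/eqP => iE; last by apply: SA; rewrite iE natrD addrK.
  by apply: SB; rewrite iE sub0r.
move=> [i _]; rewrite /F; case: ifP => // iN /reach_walk[Sn un].
by split=> //; rewrite Sn; exact: interior_position.
Qed.

(** The tail formula is integrated term by term, its terms being nonnegative. *)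
Lemma expectation_first_passage : cvgn (series (survival p q N b)) ->
  (\int[P]_w tau w)%E = (limn (series (survival p q N b)))%:E.
Proof.
move=> cs; have -> : (\int[P]_w tau w =
    \int[P]_w \sum_(0 <= n <oo) (\1_(unabsorbed n.+1) w)%:E)%E.
  by apply: eq_integral => w _; exact: first_passage_tail_sum.
rewrite integral_nneseries //; last first.
  move=> n; apply/measurable_EFinP; apply: measurable_indic.
  exact: measurable_unabsorbed.
rewrite -nneseries_EFin //; apply: eq_eseriesr => n _.
rewrite integral_indic //; last exact: measurable_unabsorbed.
by rewrite setIT; exact: P_unabsorbed.
Qed.

End Passage.

(** * Solving the three linear equations *)

Lemma exit_probabilities (R : realType) (p q : R) (a b : nat) :
  0 < p -> 0 < q -> p + q = 1 -> p != q -> (0 < a + b)%N ->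
  let pi_ i := limn (series (exit_law p q (a + b) b ^~ i)) in
  let t := limn (series (survival p q (a + b) b)) in
  [/\ pi_ (a + b)%N = (1 - (q / p) ^+ b) / (1 - (q / p) ^+ (a + b)),
      pi_ 0%N = (1 - (p / q) ^+ a) / (1 - (p / q) ^+ (a + b)),
      t = b%:R / (q - p) - (a%:R + b%:R) / (q - p) * pi_ (a + b)%N
    & pi_ 0%N = 1 - pi_ (a + b)%N].
Proof.
move=> p0 q0 pq1 pq_neq N0 pi_ t.
have [p_neq0 q_neq0] : p != 0 /\ q != 0 by split; rewrite gt_eqF.
have limE f c := @exit_law_limit R p q (a + b) b N0 (leq_addl a b)
  (ltW p0) (ltW q0) pq1 pq_neq f c.
have total : 1 = pi_ 0%N + pi_ (a + b)%N.
  rewrite [LHS](limE (fun=> 1) 0); first by rewrite mul0r addr0 !mulr1.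
  by move=> j _; rewrite !mulr1 subr0.
have drift : b%:R = pi_ (a + b)%N * (a + b)%:R + (q - p) * t.
  rewrite [LHS](limE (fun i => i%:R) (q - p)); first by rewrite mulr0 add0r.
  move=> [//|j] _ /=; rewrite -!natr1.
  have -> : q = 1 - p by move: pq1; lra.
  by ring.
pose r := q / p.
have rp : r * p = q by rewrite /r divfK.
have harmonic : r ^+ b = pi_ 0%N + pi_ (a + b)%N * r ^+ (a + b).
  rewrite [LHS](limE (fun i => r ^+ i) 0).
    by rewrite expr0 mulr1 mul0r addr0.
  move=> [//|j] _ /=; rewrite subr0 !exprS.
  have -> : p * (r * (r * r ^+ j)) + q * r ^+ j = (r * p * r + q) * r ^+ j.
    by ring.
  (* With [r * p = q] and [p + q = 1], both sides equal [q * r + q]. *)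
  rewrite rp; congr (_ * _); rewrite -[RHS]mulr1 -pq1 mulrDr rp.
  by rewrite addrC mulrC.
have r_gt0 : 0 < r by rewrite divr_gt0.
have r_neq1 : r != 1.
  by apply: contra pq_neq => /eqP r1; rewrite -[q](divfK p_neq0) -/r r1 mul1r.
(* The denominator is nonzero because [r] is positive and differs from 1, and [a + b > 0]. *)
have rN_neq1 : 1 - r ^+ (a + b) != 0.
  by rewrite subr_eq0 eq_sym pexpr_eq1 // ltW.
have qp_neq0 : q - p != 0 by rewrite subr_eq0 eq_sym.
have pi0E : pi_ 0%N = 1 - pi_ (a + b)%N by move: total; lra.
have piNE : pi_ (a + b)%N = (1 - r ^+ b) / (1 - r ^+ (a + b)).
  apply: (mulIf rN_neq1); rewrite divfK // harmonic pi0E.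
  by ring.
split=> //.
  rewrite pi0E piNE; have -> : p / q = r^-1 by rewrite /r invf_div.
  move: rN_neq1; rewrite !exprVn exprD.
  have : r ^+ a != 0 by rewrite expf_neq0 // gt_eqF.
  have : r ^+ b != 0 by rewrite expf_neq0 // gt_eqF.
  (* With [x = r^a] and [y = r^b], both sides reduce to [y (1 - x) / (1 - x y)]. *)
  move: (r ^+ a) (r ^+ b) => x y y0 x0 xy; field.
  by rewrite x0 y0 -opprB oppr_eq0 xy.
apply: (mulfI qp_neq0).
have -> : (q - p) * t = b%:R - pi_ (a + b)%N * (a + b)%:R.
  by rewrite drift; ring.
by rewrite natrD; field.
Qed.

Theorem proposition4p2 (d : measure_display) (T : measurableType d)
    (R : realType) (P : probability T R) (X : nat -> {RV P >-> R})
    (p q A B : R)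
    (Xiid : iid X)
    (XP : forall k : nat, P [set w | X k w = 1] = p%:E)
    (XN : forall k : nat, P [set w | X k w = -1] = q%:E)
    (p_gt0 : 0 < p) (q_gt0 : 0 < q) (pq1 : p + q = 1) (pq_neq : p <> q)
    (A_ge0 : 0 <= A) (B_ge0 : 0 <= B)
    (A_int : A \is a Num.int) (B_int : B \is a Num.int)
    (AB_neq0 : A + B <> 0) :
  let S := walk X in
  let tau := first_passage S A B in
  [/\ P (stopped_at S tau A)
        = ((1 - (q / p) `^ B) / (1 - (q / p) `^ (A + B)))%:E,
      P (stopped_at S tau (- B))
        = ((1 - (p / q) `^ A) / (1 - (p / q) `^ (A + B)))%:E,
      (\int[P]_w tau w)%E
        = (B / (q - p)
           - (A + B) / (q - p)
             * ((1 - (q / p) `^ B) / (1 - (q / p) `^ (A + B))))%:E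
    & (\int[P]_w tau w)%E
        = (1 / (p - q)
           * (A * ((1 - (q / p) `^ B) / (1 - (q / p) `^ (A + B)))
              - B * ((1 - (p / q) `^ A) / (1 - (p / q) `^ (A + B)))))%:E].
Proof.
(* Nonnegative integer barriers are natural numbers, so the real powers become iterated products and
   the recursion on [nat] applies. *)
have /natrP[a AE] : A \is a Num.nat by rewrite natrEint A_int.
have /natrP[b BE] : B \is a Num.nat by rewrite natrEint B_int.
move=> S tau; rewrite {}/tau {}/S.
move: pq_neq => /eqP {}pq_neq; rewrite {}AE {}BE in AB_neq0 *.
have N_gt0 : (0 < a + b)%N.
  by rewrite lt0n; apply/eqP => N0; apply: AB_neq0; rewrite -natrD N0.
have bN := leq_addl a b; have p0 := ltW p_gt0; have q0 := ltW q_gt0.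
have [Xind _] := Xiid.
have qp0 : 0 <= q / p by rewrite divr_ge0.
have pq0 : 0 <= p / q by rewrite divr_ge0.
rewrite -natrD !powR_mulrn //.
have [piN pi0 tE pi0E] := exit_probabilities p_gt0 q_gt0 pq1 pq_neq N_gt0.
have PA : P (stopped_at (walk X) (first_passage (walk X) a%:R b%:R) a%:R) =
    ((1 - (q / p) ^+ b) / (1 - (q / p) ^+ (a + b)))%:E.
  rewrite -piN -(P_stopped_at Xind XP XN pq1 (or_intror erefl)).
    by rewrite natrD addrK.
  exact: cvg_exit_lawN.
have PB : P (stopped_at (walk X) (first_passage (walk X) a%:R b%:R) (- b%:R)) =
    ((1 - (p / q) ^+ a) / (1 - (p / q) ^+ (a + b)))%:E.
  rewrite -pi0 -(P_stopped_at Xind XP XN pq1 (or_introl erefl)).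
    by rewrite sub0r.
  exact: cvg_exit_law0.
have Etau := expectation_first_passage Xind XP XN pq1
  (cvg_survival N_gt0 bN p0 q0 pq1 pq_neq).
split=> //.
  by rewrite Etau tE piN natrD.
(* The second form of the mean follows from the first by substituting [1 - pi_ (a + b)] for
   [pi_ 0]. *)
rewrite Etau tE -piN -pi0 pi0E; congr EFin.
have qp_neq0 : q - p != 0 by rewrite subr_eq0 eq_sym.
have pq_neq0 : p - q != 0 by rewrite subr_eq0.
by field; rewrite qp_neq0 pq_neq0.
Qed.
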